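(* Let $M$ be an $n\times n$ matrix with complex entries. If $\det(I_n+MP)=0$ for every $n\times n$ permutation matrix $P$, then either $Me=-e$ or $M^{\rm T}e=-e$.
   Context: $I_n$ is the identity matrix of order $n$ and $e=(1,1,\dots,1)^{\rm T}$ is the all-one column vector of length $n$. The ''or'' is inclusive. *)

(* Defs.v *)
(* MathComp world; the complex numbers are [R[i]] over a [realType]. *)
From mathcomp Require Import all_boot all_order all_algebra.
From mathcomp Require Import reals.
From mathcomp Require Import complex.

Set Implicit Arguments.
Unset Strict Implicit.
Unset Printing Implicit Defensive.

Import GRing.Theory.
Local Open Scope ring_scope.

Definition all_one (K : nzRingType) (n : nat) : 'cV[K]_n := const_mx 1.

(* Main.v *)
Require Import Defs.
From mathcomp Require Import all_boot all_order all_algebra.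
From mathcomp Require Import all_fingroup.
From mathcomp Require Import reals complex.

(** Multiplying [1 + M P] by the inverse [Q] of [P] turns the hypothesis into:
    [M + Q] is singular for every permutation matrix [Q].

    Pick [Q] for which [N = M + Q] has the largest rank.  Composing [Q] with the
    transposition of [i] and [j] subtracts from it the rank-one matrix
    [(Q d^T) d], where [d] is the row vector [e_i - e_j].  A rank-one update
    [N + u v] raises the rank as soon as [u] is not annihilated by the left
    kernel of [N] and [v] is not annihilated by its right kernel
    ([ltn_rank_rank1_update]).  By maximality, for each pair [i, j], either all
    vectors of the right kernel of [N] agree at [i] and [j], or all vectors of
    the left kernel of [Q^-1 N] do.  If two indices were distinguished by the
    first kernel and two indices by the second, then some pair would be
    distinguished by both ([constant_or_constant]).  Hence one of the two
    kernels consists of constant vectors.  Since [N] is singular, that kernel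
    is nonzero, so it contains [e] or [e^T]: either [N e = 0] or
    [e^T Q^-1 N = e^T N = 0].  As [Q e = Q^T e = e], these say [M e = - e] and
    [M^T e = - e].

    When [N] has nullity one, this is the remark that [det (N - (Q d^T) d)]
    differs from [det N] by [d (adj N) Q d^T], where [adj N] has rank one.
    Choosing the rank maximal is what removes any assumption on the nullity. *)

Set Implicit Arguments.
Unset Strict Implicit.
Unset Printing Implicit Defensive.

Import Order.TTheory GRing.Theory Num.Theory.
Local Open Scope ring_scope.

(** If [f a <> f b] then [g a = g b], and [f] separates every [k] from [a] or
    from [b], so that [g k] is this same value. *)
Lemma constant_or_constant (T : finType) (A B : eqType) (f : T -> A)
    (g : T -> B) :
  (forall i j, f i = f j \/ g i = g j) ->
  (forall i j, f i = f j) \/ (forall i j, g i = g j).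
Proof.
move=> fg.
have [/forallP fC|] := boolP [forall i, forall j, f i == f j].
  by left=> i j; apply/eqP/(forallP (fC i)).
rewrite negb_forall => /existsP[a]; rewrite negb_forall => /existsP[b fab].
have gab : g a = g b by case: (fg a b) => // /eqP; rewrite (negPf fab).
have ga k : g k = g a.
  case: (fg k a) => // fka; case: (fg k b) => [fkb|->//].
  by rewrite -fka fkb eqxx in fab.
by right=> i j; rewrite !ga.
Qed.

Section Fields.
Variable F : fieldType.

(** The first hypothesis puts [v] in the row space of [N + u *m v], which
    therefore contains that of [N]; the second makes the inclusion strict. *)
Lemma ltn_rank_rank1_update m n (N : 'M[F]_(m, n)) (u : 'cV_m) (v : 'rV_n) :
  kermx N *m u != 0 -> ~~ (v <= N)%MS -> (\rank N < \rank (N + u *m v)%R)%N.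
Proof.
move=> /cV0Pn[a Kua] vN; set N' := N + u *m v.
have vN' : (v <= N')%MS.
  have: (row a (kermx N) *m N' <= N')%MS by apply: submxMl.
  rewrite mulmxDr -row_mul mulmx_ker row0 add0r mulmxA -row_mul.
  by rewrite [row a _]mx11_scalar mul_scalar_mx mxE (eqmx_scale _ Kua).
have NN' : (N <= N')%MS.
  by rewrite -[N](addrK (u *m v)) addmx_sub ?eqmx_opp // mulmx_sub.
rewrite (ltn_leqif (mxrank_leqif_sup NN')).
by apply: contra vN; apply: submx_trans.
Qed.

Lemma perm_mx_all_one n (s : 'S_n) :
  perm_mx s *m all_one F n = all_one F n.
Proof. by rewrite -row_permE; apply/matrixP=> i j; rewrite !mxE. Qed.

Lemma tperm_mx_rank1 n (i j : 'I_n) :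
  let d : 'rV[F]_n := delta_mx 0 i - delta_mx 0 j in
  tperm_mx i j = 1%:M - d^T *m d.
Proof.
move=> d; apply/matrixP=> k l; rewrite !mxE big_ord1 !mxE !eqxx /=.
rewrite ![l == _]eq_sym.
case: tpermP => [->|->|/eqP/negPf-> /eqP/negPf->].
- rewrite eqxx; have [->|_] := eqVneq i j; first by rewrite subrr mul0r subr0.
  by rewrite subr0 mul1r opprB addrC subrK.
- rewrite eqxx; have [->|_] := eqVneq j i; first by rewrite subrr mul0r subr0.
  by rewrite sub0r mulN1r opprK addrC subrK.
- by rewrite subrr mul0r subr0.
Qed.

(** A nonzero matrix with equal rows has a column proportional to [e]. *)
Lemma mulmx_all_one_eq0 m n p (N : 'M[F]_(m, n)) (C : 'M_(n, p)) :
  (forall i j, row i C = row j C) -> C != 0 -> N *m C = 0 ->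
  N *m all_one F n = 0.
Proof.
move=> Crow /matrix0Pn[i [j Cij]] NC0.
have colC : col j C = C i j *: all_one F n.
  by apply/matrixP=> k l; move/rowP/(_ j): (Crow k i); rewrite !mxE mulr1.
apply/eqP; move/(congr1 (col j))/eqP: NC0.
by rewrite colE -mulmxA -colE colC col0 -scalemxAr scaler_eq0 (negPf Cij).
Qed.

(** The maximal-rank argument, in terms of the sums [M + Q]; it is valid over
    any field. *)
Lemma det_add_perm_mx_eq0 n (M : 'M[F]_n) :
  (forall s : 'S_n, \det (M + perm_mx s) = 0) ->
  M *m all_one F n = - all_one F n \/ M^T *m all_one F n = - all_one F n.
Proof.
move=> detM.
have [s _ smax] := @arg_maxnP 'S_n 1%g xpredT
  (fun s => \rank (M + perm_mx s)%R) isT.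
set N := M + perm_mx s in smax; set Pt : 'M[F]_n := perm_mx s^-1%g.
have trP : (perm_mx s)^T = Pt by rewrite tr_perm_mx.
have rankN : (\rank N < n)%N.
  rewrite ltn_neqAle rank_leq_row andbT.
  by rewrite -/(row_free N) row_free_unit unitmxE detM unitr0.
have C0 : cokermx N != 0 by rewrite -mxrank_eq0 mxrank_coker subn_eq0 -ltnNge.
have K0 : (kermx N)^T != 0.
  by rewrite -mxrank_eq0 mxrank_tr mxrank_ker subn_eq0 -ltnNge.
(* The columns of [cokermx N] span the right kernel of [N], and those of
   [Pt *m (kermx N)^T] are the transposes of vectors spanning the left kernel
   of [Pt *m N], so comparing rows [i] and [j] compares the entries at [i] and
   [j] of all kernel vectors at once. *)
have separated i j : row i (cokermx N) = row j (cokermx N) \/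
    row i (Pt *m (kermx N)^T) = row j (Pt *m (kermx N)^T).
  pose d : 'rV[F]_n := delta_mx 0 i - delta_mx 0 j.
  have dC p (C : 'M[F]_(n, p)) : d *m C = row i C - row j C.
    by rewrite mulmxBl -!rowE.
  have [|Cij] := eqVneq (row i (cokermx N)) (row j (cokermx N)); first by left.
  right; apply/eqP; rewrite -subr_eq0 -dC; apply: contraT => Kij.
  have Psd : M + perm_mx (s * tperm i j)%g = N + (- (perm_mx s *m d^T)) *m d.
    rewrite perm_mxM -/(tperm_mx i j) tperm_mx_rank1 -/d mulmxBr mulmx1.
    by rewrite mulNmx mulmxA addrA.
  have := smax (s * tperm i j)%g isT.
  rewrite Psd /= leqNgt ltn_rank_rank1_update //.
    by rewrite mulmxN oppr_eq0 -trmx_eq0 2!trmx_mul trP trmxK -mulmxA.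
  by rewrite submxE dC subr_eq0.
have [Crow|Krow] := constant_or_constant separated; [left|right].
  have := mulmx_all_one_eq0 Crow C0 (mulmx_coker N).
  by rewrite mulmxDl perm_mx_all_one => /eqP; rewrite addr_eq0 => /eqP.
have PtK0 : Pt *m (kermx N)^T != 0.
  apply: contraNneq K0 => /(congr1 (mulmx (perm_mx s))).
  by rewrite mulmxA -perm_mxM mulgV perm_mx1 mul1mx mulmx0 => ->.
have NPK : N^T *m perm_mx s *m (Pt *m (kermx N)^T) = 0.
  rewrite mulmxA -(mulmxA _ _ Pt) -perm_mxM mulgV perm_mx1 mulmx1.
  by rewrite -trmx_mul mulmx_ker trmx0.
have := mulmx_all_one_eq0 Krow PtK0 NPK.
rewrite -mulmxA perm_mx_all_one [N^T]linearD /= trP mulmxDl perm_mx_all_one.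
by move/eqP; rewrite addr_eq0 => /eqP.
Qed.

End Fields.

Theorem theorem5 (R : realType) (n : nat) (M : 'M[R[i]]_n) :
  (forall P : 'M[R[i]]_n, is_perm_mx P -> \det (1%:M + M *m P) = 0) ->
  M *m all_one R[i] n = - all_one R[i] n \/
  M^T *m all_one R[i] n = - all_one R[i] n.
Proof.
move=> detM; apply: det_add_perm_mx_eq0 => s.
have -> : M + perm_mx s = (1%:M + M *m perm_mx s^-1%g) *m perm_mx s.
  by rewrite mulmxDl mul1mx -mulmxA -perm_mxM mulVg perm_mx1 mulmx1 addrC.
by rewrite det_mulmx detM ?mul0r ?perm_mx_is_perm.
Qed.
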